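(* Let $G=(V,E)$ be a multigraph with $m$ edges (loops counted). Then $$h^\ast(\mathcal C_G;z)=\sum_{H}(2z)^{|H|}(1+z)^{m-|H|},$$ where the sum ranges over all subsets $H\subseteq E$ such that the graph $(V,H)$ is acyclic (contains no cycle; in particular no loop).
   Context: For a finite undirected multigraph $G=(V,E)$ (loops, parallel edges and isolated nodes allowed) with $n=|V|$, $m=|E|$, work in $\mathbb{R}^V\times\mathbb{R}^E\cong\mathbb{R}^{n+m}$ with standard basis vectors $e_u$, $e_f$. For each edge $f$ with endpoints $u,v$ ($u=v$ for a loop) set $\widetilde e_f=e_u+e_v-e_f$, $\overleftarrow e_f=e_u-e_v+e_f$, $\overrightarrow e_f=-e_u+e_v+e_f$. The cosmological polytope $\mathcal C_G$ is the convex hull of $\{e_f,\widetilde e_f,\overleftarrow e_f,\overrightarrow e_f: f\in E\}\cup\{e_u: u\in V\}$, a lattice polytope of dimension $n+m-1$. For a $d$-dimensional lattice polytope $P\subseteq\mathbb{R}^N$, the $h^\ast$-polynomial is defined by $\sum_{j\ge0}|jP\cap\mathbb{Z}^N|z^j=h^\ast(P;z)/(1-z)^{d+1}$. *)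

(* Defs.v *)
From HB Require Import structures.
From mathcomp Require Import all_boot all_order all_algebra.
From mathcomp Require Import boolp reals.
Set Implicit Arguments. Unset Strict Implicit. Unset Printing Implicit Defensive.
Import Order.TTheory GRing.Theory Num.Theory.
Local Open Scope ring_scope.

(* A finite multigraph: vertex type V, edge type E, and for each edge its
   (ordered, but the order is irrelevant) pair of endpoints; a loop has
   equal endpoints. Parallel edges, loops, isolated vertices allowed. *)

Section Cosmo.
Variables (V E : finType) (ends : E -> V * V).

Definition coord := (V + E)%type.

Definition basis (c : coord) : {ffun coord -> int} :=
  [ffun i => (i == c)%:Z].

(* index of the generating points: e_u (u in V) and, for every edge f,
   the four points e_f, ~e_f, <-e_f, ->e_f *)
Definition gen_index := (V + E * 'I_4)%type.

Definition gen (g : gen_index) : {ffun coord -> int} :=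
  match g with
  | inl u => basis (inl u)
  | inr (f, k) =>
      let u := (ends f).1 in let v := (ends f).2 in
      let eu := basis (inl u) in let ev := basis (inl v) in
      let ef := basis (inr f) in
      match val k with
      | 0%N => ef
      | 1%N => eu + ev - ef
      | 2%N => eu - ev + ef
      | _ => - eu + ev + ef
      end
  end.

(* x lies in the dilate j * C_G, where C_G = conv {gen g}: x is a
   nonnegative real combination of the generators with total weight j. *)
Definition in_dilate (R : realType) (j : nat) (x : {ffun coord -> int}) : Prop :=
  exists mu : gen_index -> R,
    (forall g, 0 <= mu g) /\
    \sum_g mu g = j%:R /\
    forall i : coord, (x i)%:~R = \sum_g mu g * ((gen g) i)%:~R.

Definition lattice_count_is (R : realType) (j c : nat) : Prop :=
  exists s : seq {ffun coord -> int},
    uniq s /\ (forall x, x \in s <-> in_dilate R j x) /\ size s = c.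

Definition joins (f : E) (a b : V) : bool :=
  (ends f == (a, b)) || (ends f == (b, a)).

(* (V,H) contains a cycle: distinct edges f_0..f_k of H and distinct
   vertices v_0..v_k with f_i joining v_i and v_{i+1 mod k+1}.
   (k = 0: a loop; k = 1: two parallel edges.) *)
Definition has_cycle (H : {set E}) : Prop :=
  exists (k : nat) (fs : k.+1.-tuple E) (vs : k.+1.-tuple V),
    [/\ uniq fs, uniq vs, all (fun f => f \in H) fs &
        forall i : 'I_k.+1, joins (tnth fs i) (tnth vs i) (tnth vs (ordS i))].

Definition acyclic (H : {set E}) : Prop := ~ has_cycle H.

(* h* polynomial: h is the h*-polynomial of the polytope (dimension d,
   D = d+1) whose dilates have lattice point counts given by [count], i.e.
   sum_j L(j) z^j = h(z) / (1-z)^D, written coefficientwise: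
   L(j) = sum_{k<=j} h_k * [z^(j-k)] (1-z)^(-D) = sum_k h_k * C(j-k+D-1, j-k). *)
Definition ehrhart_hstar (count : nat -> nat -> Prop) (D : nat)
    (h : {poly int}) : Prop :=
  forall j : nat, exists c : nat, count j c /\
    c%:Z = \sum_(k < j.+1) h`_k * ('C((j - k) + D - 1, j - k))%:Z.

Definition cosmo_hstar (R : realType) (h : {poly int}) : Prop :=
  ehrhart_hstar (@lattice_count_is R) (#|V| + #|E|) h.

End Cosmo.

(* Main.v *)
Require Import Defs.
From HB Require Import structures.
From mathcomp Require Import all_boot all_order all_algebra.
From mathcomp Require Import boolp reals.
From mathcomp Require Import zify ring.
Import Order.TTheory GRing.Theory Num.Theory.
Local Open Scope ring_scope.
Set Implicit Arguments. Unset Strict Implicit. Unset Printing Implicit Defensive.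

(** Trading each unit of [- e_f] for [e_u + e_v - e_f] (the map [twist (-1)]) turns
    lattice points of [j C_G] into pairs of a vertex vector [b] and edge values [a_f]
    with [sum_u b_u + sum_f |a_f| = j] such that [b] becomes nonnegative after
    routing along each edge [f] at most [max a_f 0] units. By Gale's theorem this is
    the system of inequalities [slack >= 0], one for each vertex set.

    For a non-loop edge [f = uv] of capacity [c], the solutions on a line in direction
    [e_v - e_u] form an interval [-A - c, B + c], with [A + B >= 0] by submodularity of
    [slack], and the lines that meet the solution set are the solutions for [G / f].
    Hence capacity [c] contributes [2 c] times the count for [G / f] on top of the
    count for [G - f]. Summing over [a_f] gives, for the Ehrhart series [S],
    [S_G = (1 + z) / (1 - z) S_(G - f) + 2 z / (1 - z)^2 S_(G / f)], which is the
    deletion-contraction recursion of the sum over forests (for a loop the second term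
    is absent). *)

(** * Counting and Ehrhart coefficients *)

Definition has_card (T : eqType) (P : T -> Prop) (c : int) : Prop :=
  exists s : seq T, [/\ uniq s, forall x, x \in s <-> P x & (size s)%:Z = c].

Lemma has_card_inj (T : eqType) (P : T -> Prop) (c c' : int) :
  has_card P c -> has_card P c' -> c = c'.
Proof.
move=> [s [us sP <-]] [s' [us' s'P <-]]; congr Posz.
apply/perm_size/uniq_perm => // x.
by apply/idP/idP => [/sP/s'P|/s'P/sP].
Qed.

Lemma has_card_image (T T' : eqType) (F : T -> T') (P : T -> Prop)
    (Q : T' -> Prop) (c : int) :
  (forall x y, P x -> P y -> F x = F y -> x = y) ->
  (forall y, Q y <-> exists2 x, P x & y = F x) ->
  has_card P c -> has_card Q c.
Proof.
move=> Finj QE [s [us sP sz]]; exists (map F s); split; last by rewrite size_map.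
- by rewrite map_inj_in_uniq // => x y /sP Px /sP Py; apply: Finj.
- move=> y; split.
  + by move/mapP => [x /sP Px ->]; apply/QE; exists x.
  + by move/QE => [x /sP xs ->]; apply: map_f.
Qed.

Lemma has_card_ext (T : eqType) (P Q : T -> Prop) (c : int) :
  (forall x, Q x <-> P x) -> has_card P c -> has_card Q c.
Proof.
move=> QP [s [us sP sz]]; exists s; split=> // x.
by split=> [/sP/QP|/QP/sP].
Qed.

Lemma has_card0 (T : eqType) (P : T -> Prop) :
  (forall x, ~ P x) -> has_card P 0.
Proof. by move=> nP; exists [::]; split => // x; split => // /nP. Qed.

Lemma has_card1 (T : eqType) (P : T -> Prop) (x0 : T) :
  (forall x, P x <-> x = x0) -> has_card P 1.
Proof.
move=> PE; exists [:: x0]; split => // x; rewrite inE.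
by split=> [/eqP/PE|/PE ->].
Qed.

(** Counting by fibres: finiteness of the whole comes from the finite list [ks] of possible keys and
    from finiteness of each fibre. *)
Lemma has_card_keyed (T K : eqType) (key : T -> K) (n : K -> int) (ks : seq K)
    (P : T -> Prop) :
  uniq ks -> (forall x, P x -> key x \in ks) ->
  (forall k, k \in ks -> has_card (fun x => P x /\ key x = k) (n k)) ->
  has_card P (\sum_(k <- ks) n k).
Proof.
elim: ks P => [|k ks IH] P /=.
  move=> _ Pks _; rewrite big_nil; apply: has_card0 => x /Pks.
  by rewrite in_nil.
move=> /andP[kks uks] Pks cnt.
have [s [us sP sz]] := cnt k (mem_head _ _).
have [||s' [us' s'P sz']] := IH (fun x => P x /\ key x != k) uks.
- by move=> x [/Pks]; rewrite inE => /orP[/eqP ->|//]; rewrite eqxx.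
- move=> l lks; apply: has_card_ext (cnt l _); last by rewrite inE lks orbT.
  move=> x; split=> [[[Px _] kx]|[Px kx]]; do ?split=> //.
  by rewrite kx; apply: contraNneq kks => <-.
exists (s ++ s'); split.
- rewrite cat_uniq us us' andbT /=; apply/hasPn => x /s'P [_ kx].
  by apply/negP => /sP [_ /eqP]; apply/negP.
- move=> x; rewrite mem_cat; split.
    by case/orP => [/sP[]|/s'P[]].
  move=> Px; have [kx|kx] := eqVneq (key x) k.
    by apply/orP; left; apply/sP.
  by apply/orP; right; apply/s'P.
- by rewrite size_cat PoszD big_cons sz sz'.
Qed.

Definition int_range (lo hi : int) : seq int :=
  [seq lo + i%:Z | i <- iota 0 (absz (hi - lo + 1))].

(** The bound admits an empty range, [lo = hi + 1]; below that, [absz] would turn a negative length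
    into a positive one. *)
Lemma mem_int_range (lo hi t : int) :
  lo <= hi + 1 -> (t \in int_range lo hi) = (lo <= t <= hi).
Proof.
move=> lohi; apply/mapP/idP => [[i]|tb].
  by rewrite mem_iota => ib ->; lia.
by exists (absz (t - lo)); [rewrite mem_iota|]; lia.
Qed.

Lemma int_range_uniq (lo hi : int) : uniq (int_range lo hi).
Proof. by rewrite map_inj_uniq ?iota_uniq // => i k /addrI []. Qed.

(* Widening every fibre interval by [c] at both ends adds [2 * c] per fibre. *)
Lemma has_card_widen (T T' : eqType) (F : T' -> int -> T)
    (F1 : T -> T') (F2 : T -> int) (P' : T' -> Prop) (P0 Pc : T -> Prop)
    (lo hi : T' -> int) (c n0 n' : int) :
  0 <= c ->
  (forall y t, P' y -> F1 (F y t) = y /\ F2 (F y t) = t) ->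
  (forall y, P' y -> lo y <= hi y) ->
  (forall x, P0 x <-> exists y t, [/\ P' y, x = F y t & lo y <= t <= hi y]) ->
  (forall x, Pc x <->
     exists y t, [/\ P' y, x = F y t & lo y - c <= t <= hi y + c]) ->
  has_card P0 n0 -> has_card P' n' -> has_card Pc (n0 + 2 * c * n').
Proof.
move=> c0 FK lohi P0E PcE cnt0 [s' [us' s'P sz']].
(* The fibre over [y] is an interval of [hi y - lo y + 1 + 2 * d] integers; [d = 0] and [d = c] give
   the two counts to be compared. *)
have gen (d : int) (P : T -> Prop) : 0 <= d ->
    (forall x, P x <->
       exists y t, [/\ P' y, x = F y t & lo y - d <= t <= hi y + d]) ->
    has_card P (\sum_(y <- s') (hi y - lo y + 1 + 2 * d)).
  move=> d0 PE; apply: (@has_card_keyed _ _ F1) => //.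
    by move=> x /PE [y [t [P'y -> _]]]; rewrite (FK _ _ P'y).1; apply/s'P.
  move=> y /s'P P'y; have lh := lohi y P'y.
  exists [seq F y t | t <- int_range (lo y - d) (hi y + d)]; split.
  - rewrite map_inj_in_uniq ?int_range_uniq // => t t' _ _ /(congr1 F2).
    by rewrite !(FK _ _ P'y).2.
  - move=> x; split.
    + move/mapP => [t]; rewrite mem_int_range; last by lia.
      by move=> tb ->; split; [apply/PE; exists y, t|rewrite (FK _ _ P'y).1].
    + case=> /PE [z [t [P'z -> tb]]]; rewrite (FK _ _ P'z).1 => <-.
      by apply: map_f; rewrite mem_int_range //; have := lohi z P'z; lia.
  - by rewrite size_map size_map size_iota; lia.
have cnt0' : has_card P0 (\sum_(y <- s') (hi y - lo y + 1 + 2 * 0)).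
  apply: gen => // x; split => [/P0E [y [t [P'y xE tb]]]|[y [t [P'y xE tb]]]].
    by exists y, t; split=> //; lia.
  by apply/P0E; exists y, t; split=> //; lia.
have -> : n0 + 2 * c * n' = \sum_(y <- s') (hi y - lo y + 1 + 2 * c).
  rewrite (has_card_inj cnt0 cnt0') [RHS]big_split [in LHS]big_split /=.
  rewrite mulr0 [in LHS]big1_eq addr0; congr (_ + _).
  by rewrite big_const_seq count_predT iter_addr_0 -(mulr_natr _ (size s')) (natz (size s')) sz'.
exact: gen.
Qed.

(* The coefficient of [z^j] in [h(z) / (1 - z)^D], also for [D = 0]: then the truncated
   [j - k + 0 - 1] makes the binomial coefficient [1] at [k = j] and [0] elsewhere. *)
Definition ehrhart_coef (D : nat) (h : {poly int}) (j : nat) : int :=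
  \sum_(k < j.+1) h`_k * ('C((j - k) + D - 1, j - k))%:Z.

Lemma ehrhart_coefD D h g j :
  ehrhart_coef D (h + g) j = ehrhart_coef D h j + ehrhart_coef D g j.
Proof.
by rewrite -big_split; apply: eq_bigr => k _; rewrite coefD mulrDl.
Qed.

Lemma ehrhart_coefMX0 D h : ehrhart_coef D ('X * h) 0 = 0.
Proof. by rewrite /ehrhart_coef big_ord1 coefXM mul0r. Qed.

Lemma ehrhart_coefMXS D h j :
  ehrhart_coef D ('X * h) j.+1 = ehrhart_coef D h j.
Proof.
rewrite /ehrhart_coef big_ord_recl coefXM mul0r add0r.
by apply: eq_bigr => k _; rewrite coefXM /= /bump leq0n add1n subSS.
Qed.

Lemma ehrhart_coefS0 D h : ehrhart_coef D.+1 h 0 = ehrhart_coef D h 0.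
Proof. by rewrite /ehrhart_coef !big_ord1 !subn0 !bin0. Qed.

(** Pascal's rule, the coefficient form of [h / (1 - z)^(D+1) = z h / (1 - z)^(D+1) + h / (1 -
    z)^D]. *)
Lemma ehrhart_coefSS D h j :
  ehrhart_coef D.+1 h j.+1 = ehrhart_coef D.+1 h j + ehrhart_coef D h j.+1.
Proof.
rewrite /ehrhart_coef big_ord_recr [in RHS](big_ord_recr j.+1) /= addrA.
rewrite !subnn !bin0 -big_split; congr (_ + _).
apply: eq_bigr => k _; rewrite /= -mulrDr; congr (_ * _).
rewrite subSn; last by rewrite -ltnS.
by rewrite !addSn !addnS !subSS !subn0 binS PoszD addrC.
Qed.

(** Multiplication by [1 / (1 - z)], for a coordinate with all nonnegative values. *)
Lemma ehrhart_coef_sum D h j :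
  ehrhart_coef D.+1 h j = \sum_(0 <= i < j.+1) ehrhart_coef D h (j - i).
Proof.
elim: j => [|j IH]; first by rewrite big_nat1 ehrhart_coefS0.
by rewrite ehrhart_coefSS IH [RHS]big_nat_recl // addrC subn0.
Qed.

(** Multiplication by [z / (1 - z)^2 = sum_i i z^i], for terms linear in the capacity. *)
Lemma ehrhart_coef_weighted_sum D h j :
  ehrhart_coef D.+2 ('X * h) j =
  \sum_(0 <= i < j.+1) i%:Z * ehrhart_coef D h (j - i).
Proof.
elim: j => [|j IH]; first by rewrite big_nat1 ehrhart_coefMX0 mul0r.
rewrite [RHS]big_nat_recl // mul0r add0r ehrhart_coefSS IH ehrhart_coefMXS.
rewrite ehrhart_coef_sum -big_split; apply: eq_bigr => i _ /=.
by rewrite subSS -[i.+1%:Z]/(1 + i)%:Z PoszD mulrDl mul1r addrC.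
Qed.

(** Multiplication by [z / (1 - z)], for the negative values of an edge coordinate. *)
Lemma ehrhart_coef_pos_sum D h j :
  ehrhart_coef D.+1 ('X * h) j =
  \sum_(1 <= i < j.+1) ehrhart_coef D h (j - i).
Proof.
case: j => [|j]; first by rewrite ehrhart_coefMX0 big_geq.
rewrite ehrhart_coefMXS ehrhart_coef_sum [RHS]big_add1 /=.
by apply: eq_bigr => i _; rewrite subSS.
Qed.

Lemma ehrhart_coef1_0 j : ehrhart_coef 0 1 j = (j == 0%N)%:Z.
Proof.
case: j => [|j]; first by rewrite /ehrhart_coef big_ord1 coef1 mul1r bin0.
rewrite /ehrhart_coef big_ord_recl big1 => [|k _].
  by rewrite coef1 mul1r subn0 addn0 bin_small ?addr0 //= subn1.
by rewrite coef1 mul0r.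
Qed.

(** * Gale's inequalities and contraction *)

Section Points.
Variables (V E : finType).
Implicit Types (ends : E -> V * V) (y : {ffun Defs.coord V E -> int}).
Implicit Types (U W : {set V}) (S : {set E}).

Definition add_at (c : Defs.coord V E) (t : int) y : {ffun Defs.coord V E -> int} :=
  [ffun i => y i + t * (i == c)%:Z].

Definition crosses ends (f : E) U : bool :=
  ((ends f).1 \in U) (+) ((ends f).2 \in U).

(** Gale's cut condition: the supply inside [U], possibly negative, plus the capacity of the cut of
    [U]. Only the positive part of an edge value is capacity. *)
Definition slack ends y U : int :=
  \sum_(u in U) y (inl u) +
  \sum_f Num.max (y (inr f)) 0 * (crosses ends f U)%:Z.

Definition weight y : int := \sum_u y (inl u) + \sum_f `|y (inr f)|.

(* Gale's condition for [y (inl _)] to become nonnegative after moving units along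
   the edges, each edge [f] carrying at most [max (y_f) 0] units. *)
Definition feasible W S ends (j : nat) y : Prop :=
  [/\ forall u, u \notin W -> y (inl u) = 0,
      forall f, f \notin S -> y (inr f) = 0,
      weight y = j%:Z & forall U, 0 <= slack ends y U].

Lemma add_at0 c y : add_at c 0 y = y.
Proof. by apply/ffunP => i; rewrite ffunE mul0r addr0. Qed.

Lemma add_at_add_at c s t y : add_at c s (add_at c t y) = add_at c (s + t) y.
Proof. by apply/ffunP => i; rewrite !ffunE mulrDl addrAC addrA. Qed.

Lemma add_atC c d s t y : add_at c s (add_at d t y) = add_at d t (add_at c s y).
Proof. by apply/ffunP => i; rewrite !ffunE addrAC. Qed.

Lemma add_at_same c t y : add_at c t y c = y c + t.
Proof. by rewrite ffunE eqxx mulr1. Qed.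

Lemma add_at_neq c t y i : i != c -> add_at c t y i = y i.
Proof. by rewrite ffunE => /negPf ->; rewrite mulr0 addr0. Qed.

Lemma sum_mul_eq_op (T : finType) (P : pred T) (c : T) (F : T -> int) :
  \sum_(i | P i) F i * (i == c)%:Z = F c * (P c)%:Z.
Proof.
rewrite big_mkcond (bigD1 c) //= big1 => [|i /negPf ->].
  by rewrite eqxx addr0; case: ifP; rewrite ?mulr1 ?mulr0.
by rewrite mulr0; case: ifP.
Qed.

Lemma slack_add_at_vertex ends c t y U :
  slack ends (add_at (inl c) t y) U = slack ends y U + t * (c \in U)%:Z.
Proof.
rewrite /slack addrAC; congr (_ + _); last first.
  by apply: eq_bigr => f _; rewrite add_at_neq.
rewrite -(sum_mul_eq_op (mem U) c (fun=> t)) -big_split.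
by apply: eq_bigr => u _; rewrite ffunE.
Qed.

Lemma slack_add_at_edge ends f a y U : y (inr f) = 0 ->
  slack ends (add_at (inr f) a y) U =
  slack ends y U + Num.max a 0 * (crosses ends f U)%:Z.
Proof.
move=> yf; rewrite /slack -addrA; congr (_ + _).
  by apply: eq_bigr => u _; rewrite add_at_neq.
rewrite (bigD1 f) //= [in RHS](bigD1 f) //= add_at_same yf maxxx mul0r !add0r.
rewrite addrC; congr (_ + _).
by apply: eq_bigr => g gf; rewrite add_at_neq.
Qed.

Lemma weight_add_at_vertex c t y : weight (add_at (inl c) t y) = weight y + t.
Proof.
rewrite /weight addrAC; congr (_ + _); last first.
  by apply: eq_bigr => f _; rewrite add_at_neq.
rewrite -[X in _ + X]mulr1 -(sum_mul_eq_op predT c (fun=> t)) -big_split.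
by apply: eq_bigr => u _; rewrite ffunE.
Qed.

Lemma weight_add_at_edge f a y : y (inr f) = 0 ->
  weight (add_at (inr f) a y) = weight y + `|a|.
Proof.
move=> yf; rewrite /weight -addrA; congr (_ + _).
  by apply: eq_bigr => u _; rewrite add_at_neq.
rewrite (bigD1 f) //= [in RHS](bigD1 f) //= add_at_same yf normr0 !add0r.
rewrite addrC; congr (_ + _).
by apply: eq_bigr => g gf; rewrite add_at_neq.
Qed.

Lemma slackT ends y : slack ends y setT = \sum_u y (inl u).
Proof.
rewrite /slack [X in _ + X]big1 ?addr0 => [|f _].
  by apply: eq_bigl => u; rewrite inE.
by rewrite /crosses !inE mulr0.
Qed.

(** The full vertex set has an empty cut, so its inequality makes the vertex total nonnegative and
    the weight bounds every [|y_f|]. This leaves finitely many edge values to sum over. *)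
Lemma feasible_edge_le W S ends j y f :
  feasible W S ends j y -> `|y (inr f)| <= j%:Z.
Proof.
move=> [_ _ <- pos]; rewrite /weight (bigD1 f) //=.
rewrite addrCA lerDl; apply: addr_ge0; last exact: sumr_ge0.
by rewrite -(slackT ends).
Qed.

(** The vertex part is modular; the cut part is submodular edge by edge, with nonnegative capacities
    as weights. *)
Lemma slack_submodular ends y (A B : {set V}) :
  slack ends y (A :|: B) + slack ends y (A :&: B) <=
  slack ends y A + slack ends y B.
Proof.
rewrite /slack addrACA [leRHS]addrACA lerD //.
  rewrite le_eqVlt; apply/orP; left; apply/eqP.
  rewrite [in RHS](big_mkcond (mem A)) [in RHS](big_mkcond (mem B)).
  rewrite [in LHS](big_mkcond (mem (A :|: B))) /=.
  rewrite [in LHS](big_mkcond (mem (A :&: B))) /=.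
  rewrite -!big_split; apply: eq_bigr => u _; rewrite !inE.
  by case: (u \in A); case: (u \in B); rewrite /= ?addr0 ?add0r.
rewrite -!big_split; apply: ler_sum => f _ /=.
rewrite -!mulrDr ler_wpM2l ?le_max ?lexx ?orbT //.
rewrite /crosses !inE.
by case: (_ \in A); case: (_ \in A); case: (_ \in B); case: (_ \in B).
Qed.

Lemma feasible_edge0 W S ends j y f : f \notin S -> y (inr f) = 0 ->
  feasible W (f |: S) ends j y <-> feasible W S ends j y.
Proof.
move=> fS yf; split=> -[yW yS tot pos]; split=> // g gS.
  have [->//|gf] := eqVneq g f; apply: yS.
  by rewrite !inE negb_or gf.
by apply: yS; apply: contra gS; rewrite inE orbC => ->.
Qed.

(* Adding to [f] a coordinate whose positive part never counts as capacity. *)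
Lemma feasible_add_at_edge W S ends j y f (a : int) :
  f \notin S -> y (inr f) = 0 -> `|a| <= j%:Z ->
  a <= 0 \/ (ends f).1 = (ends f).2 ->
  feasible W (f |: S) ends j (add_at (inr f) a y) <->
  feasible W S ends (j - absz a) y.
Proof.
move=> fS yf aj acr.
have slackE U : slack ends (add_at (inr f) a y) U = slack ends y U.
  rewrite slack_add_at_edge //; case: acr => [a0|fl].
    by rewrite max_r // mul0r addr0.
  by rewrite /crosses fl addbb mulr0 addr0.
split=> -[yW yS tot pos]; split.
- by move=> u /yW; rewrite add_at_neq.
- move=> g gS; have [->//|gf] := eqVneq g f.
  have /yS : g \notin f |: S by rewrite !inE negb_or gf.
  by rewrite add_at_neq //; apply: contra gf => /eqP[->].
- by move: tot; rewrite weight_add_at_edge //; lia.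
- by move=> U; rewrite -slackE.
- by move=> u /yW; rewrite add_at_neq.
- move=> g; rewrite !inE negb_or => /andP[gf gS].
  by rewrite add_at_neq ?yS //; apply: contra gf => /eqP[->].
- by rewrite weight_add_at_edge // tot; lia.
- by move=> U; rewrite slackE.
Qed.

(** Contraction keeps the types [V] and [E]: the head is renamed to the tail and [f] becomes a loop.
    The sets [W] and [S] in [feasible] record which vertices and edges are still present. *)
Definition contract ends (f : E) : E -> V * V :=
  let r x := if x == (ends f).2 then (ends f).1 else x in
  fun g => (r (ends g).1, r (ends g).2).

Definition contract_preim ends (f : E) U : {set V} :=
  [set x | (if x == (ends f).2 then (ends f).1 else x) \in U].

(** A cut of the contracted graph is a cut of the original one with both ends of [f] on one side.
    The head must carry value zero, since its membership may change in the preimage. *)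
Lemma slack_contract ends f y U : y (inl (ends f).2) = 0 ->
  (ends f).1 != (ends f).2 ->
  slack (contract ends f) y U = slack ends y (contract_preim ends f U).
Proof.
move=> yv uv; rewrite /slack; congr (_ + _); last first.
  by apply: eq_bigr => g _; rewrite /crosses !inE.
rewrite big_mkcond [RHS]big_mkcond; apply: eq_bigr => x _.
rewrite inE; case: (eqVneq x (ends f).2) => // ->.
by rewrite yv !if_same.
Qed.

Lemma contract_preim_id ends f U :
  ((ends f).1 \in U) = ((ends f).2 \in U) -> contract_preim ends f U = U.
Proof.
move=> uv; apply/setP => x; rewrite inE.
by case: (eqVneq x (ends f).2) => // ->.
Qed.

Lemma contract_preim_ends ends f U : (ends f).1 != (ends f).2 ->
  ((ends f).1 \in contract_preim ends f U) =
  ((ends f).2 \in contract_preim ends f U).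
Proof. by move=> uv; rewrite !inE eqxx (negPf uv). Qed.

(** [[set a]] is the default point of the minimum, admissible as soon as [a != b]. *)
Definition min_slack ends y (a b : V) : int :=
  slack ends y [arg min_(U < [set a] | (a \in U) && (b \notin U)) slack ends y U]%O.

Lemma min_slackP ends y (a b : V) (c : int) : a != b ->
  (forall U, a \in U -> b \notin U -> c <= slack ends y U) <->
  c <= min_slack ends y a b.
Proof.
move=> ab; rewrite /min_slack; case: arg_minP => [|A /andP[aA bA] Amin].
  by rewrite !inE eqxx /= eq_sym.
split=> [|cA U aU bU]; first by apply.
by apply: le_trans cA (Amin _ _); rewrite aU.
Qed.

(* Union and intersection of the two minimising sets do not separate [a] from [b]. *)
Lemma min_slackD_ge0 ends y (a b : V) : a != b ->
  (forall U, (a \in U) = (b \in U) -> 0 <= slack ends y U) ->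
  0 <= min_slack ends y a b + min_slack ends y b a.
Proof.
move=> ab pos; rewrite /min_slack; case: arg_minP => [|A /andP[aA bA] _].
  by rewrite !inE eqxx /= eq_sym.
case: arg_minP => [|B /andP[bB aB] _].
  by rewrite !inE eqxx.
apply: le_trans (slack_submodular _ _ _ _); apply: addr_ge0; apply: pos.
  by rewrite !inE aA bB orbT.
by rewrite !inE (negPf bA) (negPf aB) andbF.
Qed.

Definition shift_edge ends (f : E) (t : int) y :=
  add_at (inl (ends f).2) t (add_at (inl (ends f).1) (- t) y).

Lemma shift_edge_inr ends f t y g : shift_edge ends f t y (inr g) = y (inr g).
Proof. by rewrite !add_at_neq. Qed.

(* The fibres of the projection along [e_v - e_u] onto the contracted graph. *)
Lemma feasible_fibre W S ends j f (c : nat) y t :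
  (ends f).1 != (ends f).2 -> (ends f).1 \in W -> (ends f).2 \in W ->
  f \notin S -> y (inr f) = 0 -> y (inl (ends f).2) = 0 ->
  feasible W (f |: S) ends (j + c) (add_at (inr f) c (shift_edge ends f t y)) <->
  feasible (W :\ (ends f).2) S (contract ends f) j y /\
  - min_slack ends y (ends f).2 (ends f).1 - c%:Z <= t
    <= min_slack ends y (ends f).1 (ends f).2 + c%:Z.
Proof.
move=> uv uW vW fS yf yv.
set u := (ends f).1 in uv uW *; set v := (ends f).2 in uv vW yv *.
have slackE U : slack ends (add_at (inr f) c (shift_edge ends f t y)) U =
    slack ends y U + t * (v \in U)%:Z - t * (u \in U)%:Z
    + c%:Z * (crosses ends f U)%:Z.
  rewrite slack_add_at_edge ?shift_edge_inr // !slack_add_at_vertex.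
  by rewrite max_l // -/u -/v; lia.
have totE : weight (add_at (inr f) c (shift_edge ends f t y)) = weight y + c%:Z.
  by rewrite weight_add_at_edge ?shift_edge_inr // !weight_add_at_vertex; lia.
(* Sets that do not separate [u] and [v] give the inequalities of the contracted graph, free of [t].
   Those containing only [v] bound [t] from below, those containing only [u] from above, and the
   capacity relaxes each bound by [c]. *)
have posE : (forall U, 0 <= slack ends (add_at (inr f) c (shift_edge ends f t y)) U)
    <-> (forall U, 0 <= slack (contract ends f) y U) /\
        - min_slack ends y v u - c%:Z <= t <= min_slack ends y u v + c%:Z.
  have crossE U : crosses ends f U = (u \in U) (+) (v \in U) by [].
  split=> [pos|[pos /andP[tl tu]] U].
  - split=> [U|].
      rewrite slack_contract //; have := pos (contract_preim ends f U).
      rewrite slackE crossE /u /v contract_preim_ends // addbb.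
      by rewrite mulr0 addr0 addrK.
    have vu : v != u by rewrite eq_sym.
    have : - t - c%:Z <= min_slack ends y v u.
      apply/min_slackP => // U aU bU; have := pos U.
      by rewrite slackE crossE aU (negPf bU) /=; lia.
    have : t - c%:Z <= min_slack ends y u v.
      apply/min_slackP => // U aU bU; have := pos U.
      by rewrite slackE crossE aU (negPf bU) /=; lia.
    by lia.
  - have vu : v != u by rewrite eq_sym.
    rewrite slackE crossE.
    have [uU|uU] := boolP (u \in U); have [vU|vU] := boolP (v \in U) => /=.
    + have := pos U; rewrite slack_contract // contract_preim_id; first by lia.
      by rewrite -/u -/v uU vU.
    + have /(min_slackP _ _ _ uv) /(_ U uU vU) : t - c%:Z <= min_slack ends y u v.
        by lia.
      by lia.
    + have /(min_slackP _ _ _ vu) /(_ U vU uU) : - t - c%:Z <= min_slack ends y v u.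
        by lia.
      by lia.
    + have := pos U; rewrite slack_contract // contract_preim_id; first by lia.
      by rewrite -/u -/v (negPf uU) (negPf vU).
have Wval x : x \notin W ->
    add_at (inr f) c (shift_edge ends f t y) (inl x) = y (inl x).
  move=> xW; rewrite add_at_neq // /shift_edge -/u -/v !add_at_neq //.
    by apply: contraNneq xW => -[->].
  by apply: contraNneq xW => -[->].
have Eval g : g != f ->
    add_at (inr f) c (shift_edge ends f t y) (inr g) = y (inr g).
  by move=> gf; rewrite add_at_neq ?shift_edge_inr //; apply: contraNneq gf => -[->].
split=> [[yW yS tot /posE[pos tb]]|[[yW yS tot pos] tb]].
- split=> //; split=> //.
  + move=> x; rewrite !inE negb_and negbK; case: eqVneq => [-> //|_ /= xW].
    by rewrite -Wval // yW.
  + move=> g gS; have [->//|gf] := eqVneq g f.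
    by rewrite -Eval // yS // !inE negb_or gf.
  + by move: tot; rewrite totE; lia.
- split.
  + by move=> x xW; rewrite Wval // yW // !inE negb_and xW orbT.
  + by move=> g; rewrite !inE negb_or => /andP[gf gS]; rewrite Eval // yS.
  + by rewrite totE tot; lia.
  + by apply/posE.
Qed.

End Points.

(** * Counting feasible points *)

Section Count.
Variables (V E : finType).
Implicit Types (ends : E -> V * V) (x y : {ffun Defs.coord V E -> int}).
Implicit Types (U W : {set V}) (S : {set E}).

Lemma shift_edgeK ends f t s y :
  shift_edge ends f s (shift_edge ends f t y) = shift_edge ends f (s + t) y.
Proof.
by rewrite /shift_edge [add_at _ (- s) _]add_atC !add_at_add_at opprD.
Qed.

Lemma shift_edge_head ends f t y : (ends f).1 != (ends f).2 ->
  shift_edge ends f t y (inl (ends f).2) = y (inl (ends f).2) + t.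
Proof.
by move=> uv; rewrite add_at_same add_at_neq //; apply: contraNneq uv => -[->].
Qed.

(** On each line in direction [e_v - e_u] exactly one point has value zero at the head; it
    represents the line in the contracted graph, and [t] is the position on the line. *)
Lemma feasible_shift_edge W S ends j f (c : nat) x :
  (ends f).1 != (ends f).2 -> (ends f).1 \in W -> (ends f).2 \in W ->
  f \notin S ->
  x (inr f) = 0 /\ feasible W (f |: S) ends (j + c) (add_at (inr f) c x) <->
  exists y t, [/\ feasible (W :\ (ends f).2) S (contract ends f) j y,
    x = shift_edge ends f t y &
    - min_slack ends y (ends f).2 (ends f).1 - c%:Z <= t
    <= min_slack ends y (ends f).1 (ends f).2 + c%:Z].
Proof.
move=> uv uW vW fS; split.
  move=> [xf fx]; pose t := x (inl (ends f).2).
  pose y := shift_edge ends f (- t) x.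
  have xE : x = shift_edge ends f t y.
    by rewrite shift_edgeK subrr /shift_edge oppr0 !add_at0.
  have yf : y (inr f) = 0 by rewrite shift_edge_inr.
  have yv : y (inl (ends f).2) = 0 by rewrite shift_edge_head // subrr.
  exists y, t; move: fx; rewrite {1}xE.
  by move/(feasible_fibre _ _ _ uv uW vW fS yf yv) => [].
move=> [y [t [fy -> tb]]].
have yf : y (inr f) = 0 by case: fy => _ /(_ f fS).
have yv : y (inl (ends f).2) = 0.
  by case: fy => /(_ (ends f).2) yW _ _ _; apply: yW; rewrite !inE eqxx.
split; first by rewrite shift_edge_inr.
exact/(feasible_fibre _ _ _ uv uW vW fS yf yv).
Qed.

Lemma feasible_shift_edge0 W S ends j f x :
  (ends f).1 != (ends f).2 -> (ends f).1 \in W -> (ends f).2 \in W ->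
  f \notin S ->
  feasible W S ends j x <->
  exists y t, [/\ feasible (W :\ (ends f).2) S (contract ends f) j y,
    x = shift_edge ends f t y &
    - min_slack ends y (ends f).2 (ends f).1 <= t
    <= min_slack ends y (ends f).1 (ends f).2].
Proof.
move=> uv uW vW fS.
have := feasible_shift_edge j 0 x uv uW vW fS.
rewrite add_at0 addn0 => E0; split=> [fx|[y [t [fy xE tb]]]].
  have xf : x (inr f) = 0 by case: fx => _ /(_ f fS).
  have /E0 [y [t [fy xE tb]]] : x (inr f) = 0 /\ feasible W (f |: S) ends j x.
    by split=> //; apply/(feasible_edge0 _ _ _ fS xf).
  by exists y, t; split=> //; lia.
have /E0 [xf /(feasible_edge0 _ _ _ fS xf)] //: exists y t, [/\
    feasible (W :\ (ends f).2) S (contract ends f) j y, x = shift_edge ends f t y &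
    - min_slack ends y (ends f).2 (ends f).1 - 0%:Z <= t
    <= min_slack ends y (ends f).1 (ends f).2 + 0%:Z].
by exists y, t; split=> //; lia.
Qed.

(** Nonseparating sets are their own preimages, so feasibility after contraction gives them
    nonnegative slack, and submodularity applies. Hence no fibre is empty, even at capacity zero. *)
Lemma min_slack_contract W S ends j f y : (ends f).1 != (ends f).2 ->
  feasible (W :\ (ends f).2) S (contract ends f) j y ->
  - min_slack ends y (ends f).2 (ends f).1 <=
  min_slack ends y (ends f).1 (ends f).2.
Proof.
move=> uv [yW _ _ pos]; rewrite -subr_ge0 opprK.
apply: min_slackD_ge0 => // U Uuv.
have := pos U; rewrite slack_contract ?contract_preim_id //.
by apply: yW; rewrite !inE eqxx.
Qed.

Lemma has_card_feasible_capacity W S ends j f (c : nat) (n0 n' : int) :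
  (ends f).1 != (ends f).2 -> (ends f).1 \in W -> (ends f).2 \in W ->
  f \notin S ->
  has_card (feasible W S ends j) n0 ->
  has_card (feasible (W :\ (ends f).2) S (contract ends f) j) n' ->
  has_card (fun y => feasible W (f |: S) ends (j + c) y /\ y (inr f) = c)
    (n0 + 2 * c%:Z * n').
Proof.
move=> uv uW vW fS cnt0 cnt'.
(* The value at [f] is stripped off first, so that capacities [c] and [0] are compared on the same
   lines. *)
apply: (@has_card_image _ _ (add_at (inr f) c)
  (fun x => x (inr f) = 0 /\ feasible W (f |: S) ends (j + c) (add_at (inr f) c x))).
- move=> x x' _ _ /(congr1 (add_at (inr f) (- c%:Z))).
  by rewrite !add_at_add_at addNr !add_at0.
- move=> y; split=> [[fy yf]|[x [xf fx] ->]]; last by rewrite add_at_same xf add0r.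
  exists (add_at (inr f) (- c%:Z) y); last by rewrite add_at_add_at subrr add_at0.
  by rewrite add_at_same yf subrr add_at_add_at subrr add_at0.
have F2K y t : feasible (W :\ (ends f).2) S (contract ends f) j y ->
    shift_edge ends f t y (inl (ends f).2) = t.
  by case=> yW _ _ _; rewrite shift_edge_head // yW ?add0r // !inE eqxx.
apply: (@has_card_widen _ _ (fun y t => shift_edge ends f t y)
  (fun x => shift_edge ends f (- x (inl (ends f).2)) x)
  (fun x => x (inl (ends f).2)) _ _ _
  (fun y => - min_slack ends y (ends f).2 (ends f).1)
  (fun y => min_slack ends y (ends f).1 (ends f).2) _ _ _ _ _ _ _ _ cnt0 cnt').
- by [].
- move=> y t fy; rewrite (F2K _ _ fy); split=> //.
  by rewrite shift_edgeK addNr /shift_edge oppr0 !add_at0.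
- by move=> y; apply: min_slack_contract.
- by move=> x; apply: feasible_shift_edge0.
- by move=> x; apply: feasible_shift_edge.
Qed.

Lemma has_card_feasible_no_capacity W S ends j f (a n0 : int) :
  f \notin S -> `|a| <= j%:Z -> a <= 0 \/ (ends f).1 = (ends f).2 ->
  has_card (feasible W S ends (j - absz a)) n0 ->
  has_card (fun y => feasible W (f |: S) ends j y /\ y (inr f) = a) n0.
Proof.
move=> fS aj acr; apply: (@has_card_image _ _ (add_at (inr f) a)).
- move=> x x' _ _ /(congr1 (add_at (inr f) (- a))).
  by rewrite !add_at_add_at addNr !add_at0.
- move=> y; split=> [[fy yf]|[x fx ->]].
    exists (add_at (inr f) (- a) y); last by rewrite add_at_add_at subrr add_at0.
    apply/(feasible_add_at_edge _ fS _ aj acr); first by rewrite add_at_same yf subrr.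
    by rewrite add_at_add_at subrr add_at0.
  have xf : x (inr f) = 0 by case: fx => _ /(_ f fS).
  rewrite add_at_same xf add0r; split=> //.
  exact/(feasible_add_at_edge _ fS xf aj acr).
Qed.

Definition int_ball (j : nat) : seq int :=
  [seq i%:Z | i <- iota 0 j.+1] ++ [seq - i%:Z | i <- iota 1 j].

Lemma int_ball_uniq j : uniq (int_ball j).
Proof.
rewrite cat_uniq !map_inj_uniq ?iota_uniq //; first last.
- by move=> i k [].
- by move=> i k /oppr_inj [].
rewrite andbT /=; apply/hasPn => _ /mapP[i + ->]; rewrite mem_iota => ib.
suff : - i%:Z \notin [seq k%:Z | k <- iota 0 j.+1] by [].
by apply/negP => /mapP [k]; rewrite mem_iota => kb; lia.
Qed.

Lemma mem_int_ball j (a : int) : (a \in int_ball j) = (`|a| <= j%:Z).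
Proof.
rewrite mem_cat; apply/orP/idP => [[]/mapP[i + ->]|aj].
- by rewrite mem_iota; lia.
- by rewrite mem_iota; lia.
have [a0|a0] := leP 0 a; [left|right]; apply/mapP; exists (absz a); rewrite ?mem_iota; lia.
Qed.

Lemma sum_int_ball j (n : int -> int) :
  \sum_(a <- int_ball j) n a =
  \sum_(0 <= i < j.+1) n i%:Z + \sum_(1 <= i < j.+1) n (- i%:Z).
Proof.
by rewrite big_cat !big_map /index_iota subn0 subSS subn0.
Qed.

(** Sorting by the value [a] of [f]: each [a] uses [|a|] of the weight and contributes the count for
    the deletion; if [f] is not a loop, [a > 0] adds [2 a] times the count for the contraction,
    which has one vertex less. *)
Lemma has_card_feasible_addEdge W S ends f D h0 h1 j :
  f \notin S -> (ends f).1 \in W -> (ends f).2 \in W ->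
  (forall i, has_card (feasible W S ends i) (ehrhart_coef D.+1 h0 i)) ->
  ((ends f).1 != (ends f).2 -> forall i,
    has_card (feasible (W :\ (ends f).2) S (contract ends f) i)
      (ehrhart_coef D h1 i)) ->
  has_card (feasible W (f |: S) ends j)
    (ehrhart_coef D.+2 ((1 + 'X) * h0 +
       (if (ends f).1 == (ends f).2 then 0 else 2%:P * 'X * h1)) j).
Proof.
move=> fS uW vW cnt0 cnt1.
pose lp := (ends f).1 == (ends f).2.
pose n (a : int) : int := ehrhart_coef D.+1 h0 (j - absz a) +
  (if lp then 0 else 2 * Num.max a 0 * ehrhart_coef D h1 (j - absz a)).
suff -> : ehrhart_coef D.+2 ((1 + 'X) * h0 + (if lp then 0 else 2%:P * 'X * h1)) j
    = \sum_(a <- int_ball j) n a.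
  apply: (has_card_keyed (key := fun y => y (inr f))).
  - exact: int_ball_uniq.
  - by move=> y /(feasible_edge_le f); rewrite mem_int_ball.
  move=> a; rewrite mem_int_ball => aj; rewrite /n.
  have [a0|a0] := leP a 0.
    rewrite mulr0 mul0r if_same addr0.
    by apply: has_card_feasible_no_capacity (cnt0 _) => //; left.
  case: ifPn => [/eqP uv|uv].
    rewrite addr0.
    by apply: has_card_feasible_no_capacity (cnt0 _) => //; right.
  have aE : a = (absz a)%:Z by lia.
  have jE : j = ((j - absz a) + absz a)%N by lia.
  rewrite [in X in has_card X _]jE [in X in has_card X _]aE.
  rewrite [X in 2 * X]aE.
  by apply: has_card_feasible_capacity => //; apply: cnt1.
(* In the deletion terms, nonnegative values sum to the factor [1 / (1 - z)] and negative ones to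
   [z / (1 - z)]: together [1 + 'X] over one more power of the denominator. *)
rewrite sum_int_ball.
under [X in _ = X + _]eq_bigr do rewrite /n absz_nat max_l //.
have -> : \sum_(1 <= i < j.+1) n (- i%:Z) = ehrhart_coef D.+2 ('X * h0) j.
  rewrite ehrhart_coef_pos_sum; apply: eq_bigr => i _.
  rewrite /n abszN absz_nat max_r; last by lia.
  by rewrite mulr0 mul0r if_same addr0.
rewrite big_split /= -ehrhart_coef_sum.
rewrite mulrDl mul1r !ehrhart_coefD addrAC; congr (_ + _ + _).
case: ifP => _; first by rewrite big1 // /ehrhart_coef big1 // => k _; rewrite coef0 mul0r.
under [RHS]eq_bigr do rewrite -mulrA.
rewrite -mulr_sumr -ehrhart_coef_weighted_sum -mulrA mul_polyC.
rewrite /ehrhart_coef mulr_sumr; apply: eq_bigr => k _.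
by rewrite coefZ mulrA.
Qed.

Definition nonneg_point W j y : Prop :=
  [/\ forall u, u \notin W -> y (inl u) = 0, forall f, y (inr f) = 0,
      weight y = j%:Z & forall u, 0 <= y (inl u)].

Lemma feasible_no_edges W ends j y :
  feasible W set0 ends j y <-> nonneg_point W j y.
Proof.
split=> -[yW yS tot pos].
- have yE f : y (inr f) = 0 by rewrite yS // inE.
  split=> // u; have := pos [set u]; rewrite /slack big_set1 [X in _ + X]big1 ?addr0 //.
  by move=> f _; rewrite yE maxxx mul0r.
- split=> // U; rewrite addr_ge0 // sumr_ge0 // => f _.
  by rewrite yS maxxx mul0r.
Qed.

(** Stars and bars: each vertex of [W] gives a factor [1 / (1 - z)], found by summing over the value
    at one vertex and removing it. *)
Lemma has_card_nonneg_point W j :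
  has_card (nonneg_point W j) (ehrhart_coef #|W| 1 j).
Proof.
have [n nW] := ubnP #|W|; elim: n W nW j => // n IH W nW j.
have [->|[w wW]] := set_0Vmem W.
  rewrite cards0 ehrhart_coef1_0.
  have weight0 : weight ([ffun=> 0] : {ffun Defs.coord V E -> int}) = 0.
    by rewrite /weight !big1 // => i _; rewrite ffunE.
  have y0 y : nonneg_point set0 j y -> y = [ffun=> 0].
    case=> yW yE _ _; apply/ffunP => -[u|f]; rewrite ffunE ?yE //.
    by rewrite yW // inE.
  case: (eqVneq j 0%N) => [j0|jn0].
    apply: (has_card1 (x0 := [ffun=> 0])) => y; split=> [/y0//|->].
    by split=> // *; rewrite ?ffunE // weight0 j0.
  apply: has_card0 => y fy; case: (fy) => _ _ + _.
  by rewrite (y0 _ fy) weight0; lia.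
have cW : #|W| = #|W :\ w|.+1 by rewrite (cardsD1 w W) wW.
rewrite cW ehrhart_coef_sum.
have -> : \sum_(0 <= i < j.+1) ehrhart_coef #|W :\ w| 1 (j - i) =
    \sum_(a <- [seq i%:Z | i <- iota 0 j.+1]) ehrhart_coef #|W :\ w| 1 (j - absz a).
  by rewrite big_map /index_iota subn0.
apply: (has_card_keyed (key := fun y => y (inl w))).
- by rewrite map_inj_uniq ?iota_uniq // => i k [].
- move=> y [yW yE tot pos]; apply/mapP; exists (absz (y (inl w))); last first.
    by rewrite gez0_abs.
  have : y (inl w) <= j%:Z.
    rewrite -tot /weight [X in _ + X]big1 => [|f _]; last by rewrite yE normr0.
    by rewrite addr0 (bigD1 w) //= lerDl sumr_ge0.
  by move: (pos w); rewrite mem_iota /=; case: (y (inl w)) => // a; lia.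
move=> _ /mapP[i + ->]; rewrite mem_iota => ib.
apply: (@has_card_image _ _ (add_at (inl w) i) _ _ _ _ _ (IH _ _ _)).
- move=> x x' _ _ /(congr1 (add_at (inl w) (- i%:Z))).
  by rewrite !add_at_add_at addNr !add_at0.
- move=> y; split=> [[[yW yE tot pos] yw]|[x [xW xE tot pos] ->]].
    exists (add_at (inl w) (- i%:Z) y); last by rewrite add_at_add_at subrr add_at0.
    have yu u : u != w -> add_at (inl w) (- i%:Z) y (inl u) = y (inl u).
      by move=> uw; rewrite add_at_neq //; apply: contraNneq uw => -[->].
    split.
    + move=> u; rewrite !inE negb_and negbK.
      have [-> _|uw /= uW] := eqVneq u w; first by rewrite add_at_same yw subrr.
      by rewrite yu ?yW.
    + by move=> f; rewrite add_at_neq.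
    + by rewrite weight_add_at_vertex tot absz_nat; lia.
    + move=> u; have [->|uw] := eqVneq u w; first by rewrite add_at_same yw subrr.
      by rewrite yu.
  have xw : x (inl w) = 0 by rewrite xW // !inE eqxx.
  have xu u : u != w -> add_at (inl w) i x (inl u) = x (inl u).
    by move=> uw; rewrite add_at_neq //; apply: contraNneq uw => -[->].
  split; last by rewrite add_at_same xw add0r.
  split.
  + move=> u uW; have uw : u != w by apply: contraNneq uW => ->.
    by rewrite xu // xW // !inE negb_and uW orbT.
  + by move=> f; rewrite add_at_neq.
  + by rewrite weight_add_at_vertex tot absz_nat; lia.
  + move=> u; have [->|uw] := eqVneq u w; first by rewrite add_at_same xw add0r.
    by rewrite xu.
- by rewrite -ltnS -cW.
Qed.

End Count.

(** * Acyclicity under contraction *)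

Lemma connect_homo (T T' : finType) (e : rel T) (e' : rel T') (h : T -> T') :
  (forall a b, e a b -> connect e' (h a) (h b)) ->
  forall a b, connect e a b -> connect e' (h a) (h b).
Proof.
move=> eh a b /connectP [p + ->]; elim: p a => [|c p IH] a //=.
by case/andP=> /eh ac /IH; apply: connect_trans.
Qed.

Section Acyclic.
Variables (V E : finType).
Implicit Types (ends : E -> V * V) (H S : {set E}) (f g : E) (a b : V).

Definition adj ends H : rel V := fun a b => [exists f in H, joins ends f a b].

Definition conn ends H : rel V := connect (adj ends H).

Lemma joinsC ends f a b : joins ends f a b = joins ends f b a.
Proof. exact: orbC. Qed.

Lemma joins_ends ends f : joins ends f (ends f).1 (ends f).2.
Proof. by rewrite /joins -surjective_pairing eqxx. Qed.

Lemma adj_joins ends H f a b : f \in H -> joins ends f a b -> adj ends H a b.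
Proof. by move=> fH fab; apply/exists_inP; exists f. Qed.

Lemma connC ends H a b : conn ends H a b = conn ends H b a.
Proof.
move: a b; apply: sym_connect_sym => a b.
by apply: eq_existsb => f; rewrite joinsC.
Qed.

Lemma conn_trans ends H : transitive (conn ends H).
Proof. exact: connect_trans. Qed.

Lemma conn_ends ends H f : f \in H -> conn ends H (ends f).1 (ends f).2.
Proof. by move=> fH; apply/connect1/(adj_joins fH)/joins_ends. Qed.

Lemma conn_sub ends H S a b : H \subset S -> conn ends H a b -> conn ends S a b.
Proof.
move=> HS; apply: (connect_homo (h := id)) => {}a {}b /exists_inP [f fH fab].
by apply: connect1; apply: adj_joins fab; apply: (subsetP HS).
Qed.

Lemma conn0 ends a b : conn ends set0 a b -> a = b.
Proof.
case/connectP => -[|c p] /=; first by [].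
by case/andP => /exists_inP [f]; rewrite inE.
Qed.

(** A walk can be cut down to at most one passage through [f]: in the induction, a later passage
    either replaces or cancels the first. *)
Lemma conn_setU1 ends H f a b : conn ends (f |: H) a b ->
  [\/ conn ends H a b,
      conn ends H a (ends f).1 /\ conn ends H (ends f).2 b |
      conn ends H a (ends f).2 /\ conn ends H (ends f).1 b].
Proof.
case/connectP => p + ->; elim: p a => [|c p IH] a /=.
  by move=> _; constructor 1; apply: connect0.
case/andP => /exists_inP [g gin gac] /IH {IH}; set d := last c p => IH.
move: gin; rewrite in_setU1 => /orP[/eqP gf|gH]; last first.
  have ac : conn ends H a c by apply/connect1/adj_joins/gac.
  case: IH => [cd|[c1 d2]|[c2 d1]].
  - by constructor 1; apply: conn_trans cd.
  - by constructor 2; split=> //; apply: conn_trans c1.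
  - by constructor 3; split=> //; apply: conn_trans c2.
subst g; case/orP: gac => /eqP fE; rewrite fE /= in IH *.
- case: IH => [cd|[c1 d2]|[c2 d1]].
  + by constructor 2; split=> //; apply: connect0.
  + by constructor 2; split=> //; apply: connect0.
  + by constructor 1.
- case: IH => [cd|[c1 d2]|[c2 d1]].
  + by constructor 3; split=> //; apply: connect0.
  + by constructor 1.
  + by constructor 3; split=> //; apply: connect0.
Qed.

(** The edge [f] joins [x] to [r x] whenever they differ, so walks lift by inserting passages
    through [f]; conversely [r] collapses such passages to a point. *)
Lemma conn_contract ends H f (r := fun x =>
    if x == (ends f).2 then (ends f).1 else x) a b :
  conn (contract ends f) H (r a) (r b) = conn ends (f |: H) a b.
Proof.
have rc x : conn ends (f |: H) (r x) x.
  rewrite /r; case: eqP => [->|_]; last exact: connect0.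
  by apply: conn_ends; rewrite setU11.
apply/idP/idP => [cab|].
- have : conn ends (f |: H) (r a) (r b).
    move: cab; apply: (connect_homo (h := id)) => x y /exists_inP [g gH].
    have g12 : conn ends (f |: H) (ends g).1 (ends g).2.
      by apply: conn_ends; rewrite setU1r.
    have rg12 : conn ends (f |: H) (r (ends g).1) (r (ends g).2).
      by apply: conn_trans (rc _) (conn_trans g12 _); rewrite connC.
    by case/orP => /eqP[<- <-] //; rewrite -/(conn _ _ _ _) connC.
  move=> rab; have bb : conn ends (f |: H) (r b) b by apply: rc.
  by apply: conn_trans (conn_trans rab bb); rewrite connC.
- apply: connect_homo => x y /exists_inP [g].
  rewrite in_setU1 => /orP[/eqP -> fxy|gH gxy].
    suff -> : r x = r y by apply: connect0.
    by case/orP: fxy => /eqP fE; rewrite /r fE /= eqxx; case: eqP.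
  apply/connect1/(adj_joins gH).
  by case/orP: gxy => /eqP gE; rewrite /joins /contract gE eqxx ?orbT.
Qed.

Lemma has_cycle_conn ends H : has_cycle ends H ->
  exists2 f, f \in H & conn ends (H :\ f) (ends f).1 (ends f).2.
Proof.
case=> k [fs [vs [/tuple_uniqP fs_inj /tuple_uniqP vs_inj /all_tnthP fsH fsj]]].
exists (tnth fs ord0); first exact: fsH.
(* Walk along the rest of the cycle, by induction on the number [t] of steps left; at [t = 0] the
   index is [k] and [ordS] wraps round to [0]. *)
have back t : forall i : 'I_k.+1, (i + t = k)%N ->
    conn ends (H :\ tnth fs ord0) (tnth vs (ordS i)) (tnth vs ord0).
  elim: t => [|t IH] i it.
    suff -> : ordS i = ord0 by apply: connect0.
    by apply: val_inj; rewrite /= -[i : nat]addn0 it modnn.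
  have iS : ordS i = i.+1 :> nat by rewrite /= modn_small //; lia.
  apply: conn_trans (IH (ordS i) _); last by rewrite iS; lia.
  apply/connect1/(adj_joins _ (fsj (ordS i))).
  rewrite !inE fsH andbT; apply: contraTneq isT => /fs_inj /(congr1 val).
  by rewrite /= in iS *; rewrite iS.
have := back k ord0 (add0n k).
by case/orP: (fsj ord0) => /eqP ->; rewrite //= connC.
Qed.

(** A simple path between the ends of [f] avoiding [f], closed up by [f], is a cycle; for a loop the
    path is empty and [k = 0]. *)
Lemma conn_has_cycle ends H f : f \in H ->
  conn ends (H :\ f) (ends f).1 (ends f).2 -> has_cycle ends H.
Proof.
move=> fH /connectP [p0 p0P]; case/shortenP: p0P => p pP pU _ bE.
set a := (ends f).1 in pP pU bE.
pose k := size p; pose vs : k.+1.-tuple V := in_tuple (a :: p).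
have ordSk (i : 'I_k.+1) : (i < k)%N -> ordS i = i.+1 :> nat.
  by move=> ik; rewrite /= modn_small.
have vs_inj : injective (tnth vs) by apply/tuple_uniqP.
have vsE (i : 'I_k.+1) : tnth vs i = nth a (a :: p) i by rewrite (tnth_nth a).
(* The path supplies the edges at positions below [k]; the last component records that [f] occurs at
   position [k] only. *)
have [i|fs fsP] := @fin_all_exists 'I_k.+1 (fun=> E) (fun i g =>
    [&& g \in H, joins ends g (tnth vs i) (tnth vs (ordS i)) &
        (g == f) == (i == k :> nat)]).
  have [ik|ik] := ltnP i k.
    have /exists_inP [g] := (pathP a pP) i ik.
    rewrite !inE => /andP[gf gH] gj; exists g.
    rewrite gH (negPf gf) eq_sym (ltn_eqF ik) eqxx andbT /=.
    by rewrite !vsE ordSk.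
  have ik' : i = k :> nat by apply/eqP; rewrite eqn_leq -ltnS ltn_ord.
  exists f; rewrite fH ik' !eqxx andbT /=.
  have -> : ordS i = ord0 by apply: val_inj; rewrite /= ik' modnn.
  rewrite joinsC !vsE ik' /= -[k]/(size (a :: p)).-1 nth_last /= -bE.
  exact: joins_ends.
exists k, [tuple fs i | i < k.+1], vs; split.
- apply/tuple_uniqP => i j; rewrite !tnth_mktuple => fij.
  have /and3P [_ ji /eqP ik] := fsP i; have /and3P [_ jj /eqP jk] := fsP j.
  have ijk : (i == k :> nat) = (j == k :> nat) by rewrite -ik -jk fij.
  have [iek|ink] := eqVneq (i : nat) k.
    by apply: val_inj; rewrite /= iek; apply/esym/eqP; rewrite -ijk iek.
  have jnk : j != k :> nat by rewrite -ijk.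
  have iS := ordSk i; have jS := ordSk j.
  have ilt := ltn_ord i; have jlt := ltn_ord j.
  (* Equal edges have equal pairs of ends. As the vertices are distinct, either the positions agree
     or each is the successor of the other, which cannot happen below [k]. *)
  have eS : tnth vs i = tnth vs j \/
      tnth vs i = tnth vs (ordS j) /\ tnth vs (ordS i) = tnth vs j.
    by move: ji jj; rewrite /joins fij => /orP[] /eqP -> /orP[] /eqP [-> ->]; auto.
  case: eS => [/vs_inj //|[/vs_inj /(congr1 val) i_j /vs_inj /(congr1 val) j_i]].
  by move: i_j j_i; rewrite -[val (ordS i)]/(nat_of_ord _)
    -[val (ordS j)]/(nat_of_ord _) /= in iS jS *; lia.
- exact/tuple_uniqP.
- by apply/all_tnthP => i; rewrite tnth_mktuple; case/and3P: (fsP i).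
- by move=> i; rewrite tnth_mktuple; case/and3P: (fsP i).
Qed.

(** Every edge is a bridge: this expresses acyclicity by connectivity alone, which is easy to follow
    through a contraction. *)
Lemma acyclicP ends H : acyclic ends H <->
  forall f, f \in H -> ~~ conn ends (H :\ f) (ends f).1 (ends f).2.
Proof.
split=> [acy f fH|acy /has_cycle_conn [f fH]]; last exact/negP/acy.
by apply/negP => /(conn_has_cycle fH).
Qed.

Lemma acyclicU1 ends H f : f \notin H ->
  acyclic ends (f |: H) <->
  (ends f).1 != (ends f).2 /\ acyclic (contract ends f) H.
Proof.
move=> fH; rewrite !acyclicP.
have D1E g : g \in H -> (f |: H) :\ g = f |: (H :\ g).
  move=> gH; apply/setP => h; rewrite !inE; have [->|//] := eqVneq h f.
  by rewrite /= andbT; apply: contraNneq fH => ->.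
have contractE g : g \in H ->
    conn (contract ends f) (H :\ g) (contract ends f g).1 (contract ends f g).2 =
    conn ends ((f |: H) :\ g) (ends g).1 (ends g).2.
  by move=> gH; rewrite D1E // -conn_contract.
split=> [acy|[uv acy]].
- split=> [|g gH]; last by rewrite contractE // acy // setU1r.
  apply: contraTneq (acy f (setU11 _ _)) => ->.
  by rewrite negbK; apply: connect0.
- move=> g; rewrite in_setU1 => /orP[/eqP ->|gH]; last by rewrite -contractE ?acy.
  rewrite setU1K //; apply/negP => cuv.
  (* Suppose [H] joins the ends of [f]. A minimal joining set [B] is nonempty, as [f] is no loop,
     and its walk must pass through any [h] in [B]. Then [B :\ h] together with [f] joins the ends
     of [h], which should be a bridge. *)
  have [B /minsetP [Buv Bmin] BH] :=
    @minset_exists _ (fun A => conn ends A (ends f).1 (ends f).2) _ cuv.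
  have [B0|[h hB]] := set_0Vmem B.
    by rewrite B0 in Buv; rewrite (conn0 Buv) eqxx in uv.
  have hH : h \in H by apply: (subsetP BH).
  have Bh : ~~ conn ends (B :\ h) (ends f).1 (ends f).2.
    apply/negP => Bh; have := Bmin _ Bh (subsetDl _ _).
    by move/setP/(_ h); rewrite !inE eqxx hB.
  have sub : B :\ h \subset (f |: H) :\ h.
    by rewrite D1E //; apply: subsetU; rewrite setSD ?orbT.
  have := acy h hH; rewrite contractE // => /negP; apply.
  have fc : conn ends ((f |: H) :\ h) (ends f).1 (ends f).2.
    by apply: conn_ends; rewrite D1E // setU11.
  move: Buv; rewrite -(setD1K hB) => /conn_setU1 [Bc|[c1 c2]|[c1 c2]].
  + by rewrite Bc in Bh.
  + move/(conn_sub sub): c1; move/(conn_sub sub): c2 => c2 c1.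
    by rewrite connC; apply: conn_trans c2 _; rewrite connC; apply: conn_trans fc; rewrite connC.
  + move/(conn_sub sub): c1; move/(conn_sub sub): c2 => c2 c1.
    by apply: conn_trans c2 _; rewrite connC; apply: conn_trans fc; rewrite connC.
Qed.

(** * Deletion and contraction for the sum over forests *)

Definition forest_sum ends S : {poly int} :=
  \sum_(H : {set E} | (H \subset S) && `[< acyclic ends H >])
    (2%:P * 'X) ^+ #|H| * (1 + 'X) ^+ (#|S| - #|H|).

Lemma forest_sum0 ends : forest_sum ends set0 = 1.
Proof.
rewrite /forest_sum (big_pred1 set0) => [|H]; first by rewrite cards0 !expr0 mulr1.
rewrite subset0 /=; have [->|//] := eqVneq H set0; apply/asboolP/acyclicP => f.
by rewrite inE.
Qed.

(** Forests avoiding [f] are those of the deletion, with one more factor [1 + 'X]; forests through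
    [f] correspond, by removing [f], to those of the contraction, and a loop lies in none. *)
Lemma forest_sumU1 ends S f : f \notin S ->
  forest_sum ends (f |: S) = (1 + 'X) * forest_sum ends S +
    (if (ends f).1 == (ends f).2 then 0
     else 2%:P * 'X * forest_sum (contract ends f) S).
Proof.
move=> fS; rewrite /forest_sum (bigID (fun H : {set E} => f \in H)) /= addrC.
have cS : #|f |: S| = #|S|.+1 by rewrite cardsU1 fS.
congr (_ + _).
  rewrite mulr_sumr; apply: eq_big => [H|H /andP[/andP[HS _] fH]].
    rewrite andbAC; congr (_ && _); apply/andP/idP => [[HS fH]|HS].
      apply/subsetP => g gH; have := subsetP HS _ gH; rewrite in_setU1.
      by case/orP => // /eqP gf; rewrite -gf gH in fH.
    split; first by rewrite subsetU // HS orbT.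
    by apply: contra fS; apply: (subsetP HS).
  have HS' : H \subset S.
    apply/subsetP => g gH; have := subsetP HS _ gH; rewrite in_setU1.
    by case/orP => // /eqP gf; rewrite -gf gH in fH.
  by rewrite cS subSn ?subset_leq_card // exprS mulrCA.
rewrite (reindex_onto (fun H => f |: H) (fun H => H :\ f)) /=; last first.
  by move=> H /andP[_ fH]; rewrite setD1K.
(* The last condition, produced by the reindexing, says that [f] is not in [H]. *)
have condE H : ((f |: H \subset f |: S) && `[< acyclic ends (f |: H) >]
      && (f \in f |: H) && ((f |: H) :\ f == H)) =
    ((ends f).1 != (ends f).2) &&
    ((H \subset S) && `[< acyclic (contract ends f) H >]).
  rewrite setU11 andbT; have [fH|fH] := boolP (f \in H).
    rewrite [RHS]andbCA (negPf (_ : ~~ (H \subset S))) /=; last first.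
      by apply: contra fS => /subsetP; apply.
    apply/negbTE; rewrite negb_and; apply/orP; right.
    by apply: contraTneq fH => <-; rewrite !inE eqxx.
  rewrite setU1K // eqxx andbT [RHS]andbCA; congr (_ && _).
    rewrite subUset sub1set setU11 /=; apply/subsetP/subsetP => HS g gH.
      have := HS g gH; rewrite in_setU1 => /orP[/eqP gf|//].
      by rewrite -gf gH in fH.
    by rewrite setU1r // HS.
  apply/asboolP/andP => [/(acyclicU1 _ fH)[uv acy]|[uv /asboolP acy]].
    by split=> //; apply/asboolP.
  exact/(acyclicU1 _ fH).
under eq_bigl => H do rewrite condE.
case: eqP => /= _; first by rewrite big_pred0_eq.
rewrite mulr_sumr; apply: eq_bigr => H /andP[HS _].
have fH : f \notin H by apply: contra fS; apply: (subsetP HS).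
by rewrite cS cardsU1 fH subSS exprS -!mulrA.
Qed.

(** Induction on the edges present: deletion lowers [#|S|], contraction also lowers [#|W|], in step
    with the denominators of the recursion. The ends stay in place because contraction maps [W] into
    [W] without the head of [f]. *)
Lemma has_card_feasible (W : {set V}) S ends j :
  (forall f, f \in S -> ((ends f).1 \in W) && ((ends f).2 \in W)) ->
  has_card (feasible W S ends j)
    (ehrhart_coef (#|W| + #|S|) (forest_sum ends S) j).
Proof.
have [n] := ubnP #|S|; elim: n S W ends j => // n IH S W ends j nS endsW.
have [->|[f fS]] := set_0Vmem S.
  rewrite cards0 addn0 forest_sum0.
  apply: has_card_ext (has_card_nonneg_point _ W j) => y.
  exact: feasible_no_edges.
have /andP[uW vW] := endsW f fS.
have cS : #|S| = #|S :\ f|.+1 by rewrite (cardsD1 f S) fS.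
have cW : #|W| = #|W :\ (ends f).2|.+1 by rewrite (cardsD1 (ends f).2 W) vW.
have fS' : f \notin S :\ f by rewrite !inE eqxx.
rewrite -{1 3}(setD1K fS) forest_sumU1 // cS cW addSn addnS.
apply: has_card_feasible_addEdge => // [i|uv i].
  rewrite -addSn -cW; apply: IH; first by rewrite -ltnS -cS.
  by move=> g; rewrite inE => /andP[_ /endsW].
apply: IH; first by rewrite -ltnS -cS.
move=> g; rewrite inE => /andP[_ /endsW /andP[g1 g2]].
have contractW x : x \in W ->
    (if x == (ends f).2 then (ends f).1 else x) \in W :\ (ends f).2.
  by move=> xW; rewrite !inE; case: ifPn => [_|->]; rewrite ?uv.
by rewrite /contract !contractW.
Qed.

End Acyclic.

(** * Dilates of the cosmological polytope *)

Section Dilates.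
Variables (V E : finType) (ends : E -> V * V).
Implicit Types (x y : {ffun Defs.coord V E -> int}) (f : E) (u : V).
Implicit Types (c : Defs.coord V E).

(** A loop counts its vertex twice, in agreement with the generator [e_u + e_v - e_f] for
    [u = v]. *)
Definition endpoint_mult f u : int :=
  (u == (ends f).1)%:Z + (u == (ends f).2)%:Z.

Definition twist (s : int) x : {ffun Defs.coord V E -> int} :=
  [ffun i => match i with
   | inl u => x (inl u) + s * \sum_f endpoint_mult f u * Num.max (- x (inr f)) 0
   | inr f => x (inr f)
   end].

(** Every twist fixes the edge values, so the parameters add and [twist 1] is inverse to
    [twist (-1)]. *)
Lemma twist_twist s t x : twist s (twist t x) = twist (s + t) x.
Proof.
apply/ffunP => -[u|f]; rewrite !ffunE //= mulrDl -addrA; congr (_ + _).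
rewrite addrC; congr (_ * _ + _); apply: eq_bigr => f _; rewrite ffunE //.
Qed.

Lemma twist0 x : twist 0 x = x.
Proof. by apply/ffunP => -[u|f]; rewrite ffunE // mul0r addr0. Qed.

Lemma twist_add_vertex s u t x :
  twist s (add_at (inl u) t x) = add_at (inl u) t (twist s x).
Proof.
apply/ffunP => -[w|f]; last by rewrite ffunE !add_at_neq ?ffunE.
rewrite !ffunE addrAC; congr (_ + _ * _ + _).
by apply: eq_bigr => f _; rewrite add_at_neq.
Qed.

Lemma twist_add_edge s f a x : x (inr f) = 0 ->
  twist s (add_at (inr f) a x) =
  add_at (inr f) a (add_at (inl (ends f).1) (s * Num.max (- a) 0)
    (add_at (inl (ends f).2) (s * Num.max (- a) 0) (twist s x))).
Proof.
move=> xf; apply/ffunP => -[u|g].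
  rewrite [RHS]add_at_neq // !ffunE mulr0 addr0 -!addrA; congr (_ + _).
  rewrite -!mulrA -!mulrDr; congr (_ * _).
  rewrite (bigD1 f) //= [in RHS](bigD1 f) //= add_at_same xf add0r oppr0 maxxx.
  rewrite mulr0 add0r addrC; congr (_ + _).
    by apply: eq_bigr => g gf; rewrite add_at_neq //; apply: contraNneq gf => -[->].
  by rewrite mulrC addrC.
by rewrite !ffunE !mulr0 !addr0.
Qed.

(** * Linear functionals on the dilates *)

Definition pairing (l : Defs.coord V E -> int) x : int := \sum_i l i * x i.

Lemma pairingD l x y : pairing l (x + y) = pairing l x + pairing l y.
Proof.
by rewrite -big_split; apply: eq_bigr => i _; rewrite ffunE mulrDr.
Qed.

Lemma pairingN l x : pairing l (- x) = - pairing l x.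
Proof.
by rewrite -sumrN; apply: eq_bigr => i _; rewrite ffunE mulrN.
Qed.

Lemma pairing_basis l c : pairing l (basis c) = l c.
Proof.
rewrite /pairing -[RHS]mulr1 -(sum_mul_eq_op predT c l).
by apply: eq_bigr => i _; rewrite ffunE.
Qed.

Definition gen_pairing (l : Defs.coord V E -> int) (g : gen_index V E) : int :=
  match g with
  | inl u => l (inl u)
  | inr (f, k) => match val k with
    | 0%N => l (inr f)
    | 1%N => l (inl (ends f).1) + l (inl (ends f).2) - l (inr f)
    | 2%N => l (inl (ends f).1) - l (inl (ends f).2) + l (inr f)
    | _ => - l (inl (ends f).1) + l (inl (ends f).2) + l (inr f)
    end
  end.

Lemma pairing_gen l g : pairing l (gen ends g) = gen_pairing l g.
Proof.
case: g => [u|[f [[|[|[|k]]] kP]]];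
  by rewrite /= ?pairingD ?pairingN !pairing_basis.
Qed.

Section Real.
Variable R : realType.

Lemma pairing_dilate (mu : gen_index V E -> R) x l :
  (forall i, (x i)%:~R = \sum_g mu g * (gen ends g i)%:~R) ->
  (pairing l x)%:~R = \sum_g mu g * (gen_pairing l g)%:~R.
Proof.
move=> xE; rewrite /pairing rmorph_sum /=.
under eq_bigr do rewrite rmorphM /= xE mulr_sumr.
rewrite exchange_big /=; apply: eq_bigr => g _.
rewrite -pairing_gen /pairing rmorph_sum mulr_sumr /=; apply: eq_bigr => i _.
by rewrite rmorphM /= mulrCA.
Qed.

Lemma sum_endpoint_mult (U : {set V}) f :
  \sum_(u in U) endpoint_mult f u =
  ((ends f).1 \in U)%:Z + ((ends f).2 \in U)%:Z.
Proof.
rewrite /endpoint_mult big_split /=.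
rewrite -[X in _ = X + _]mul1r -[X in _ = _ + X]mul1r.
rewrite -(sum_mul_eq_op (mem U) _ (fun=> 1)) -(sum_mul_eq_op (mem U) _ (fun=> 1)).
by congr (_ + _); apply: eq_bigr => u _; rewrite mul1r.
Qed.

Lemma sum_twist (U : {set V}) s x :
  \sum_(u in U) twist s x (inl u) = \sum_(u in U) x (inl u) +
  s * \sum_f (((ends f).1 \in U)%:Z + ((ends f).2 \in U)%:Z) *
    Num.max (- x (inr f)) 0.
Proof.
under eq_bigr do rewrite ffunE.
rewrite big_split -mulr_sumr exchange_big /=; congr (_ + _ * _).
by apply: eq_bigr => f _; rewrite -mulr_suml sum_endpoint_mult.
Qed.

(** An edge value [a] takes [2 max (-a) 0] from the vertices, and [|a| - 2 max (-a) 0 = a]. *)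
Lemma weight_twist x : weight (twist (-1) x) = pairing (fun=> 1) x.
Proof.
rewrite /weight /pairing big_sumType /=.
have -> : \sum_u twist (-1) x (inl u) = \sum_(u in [set: V]) twist (-1) x (inl u).
  by apply: eq_bigl => u; rewrite inE.
rewrite sum_twist -addrA; congr (_ + _).
  by apply: eq_big => [u|u _]; rewrite ?inE ?mul1r.
rewrite mulN1r -sumrN -big_split; apply: eq_bigr => f _ /=.
by rewrite ffunE !inE mul1r; move: (x (inr f)) => a; lia.
Qed.

(* On the hyperplanes where edges inside [U] change sign, [slack] is only piecewise
   linear; this is the linear piece containing [x]. *)
Definition slack_normal x (U : {set V}) : Defs.coord V E -> int := fun i =>
  match i with
  | inl u => (u \in U)%:Z
  | inr f => if crosses ends f U then 1
             else if ((ends f).1 \in U) && (x (inr f) < 0) then 2 else 0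
  end.

(** For a crossing edge of value [a], capacity and twist give [max a 0 - max (-a) 0 = a]; for an
    edge inside [U] the twist gives [- 2 max (-a) 0], which is [2 a] or [0] by the sign of [a]. *)
Lemma slack_twist x U :
  slack ends (twist (-1) x) U = pairing (slack_normal x U) x.
Proof.
rewrite /slack /pairing big_sumType /= sum_twist -addrA; congr (_ + _).
  rewrite big_mkcond; apply: eq_bigr => u _ /=.
  by case: (u \in U); rewrite ?mul1r ?mul0r.
rewrite mulN1r -sumrN -big_split; apply: eq_bigr => f _ /=.
rewrite ffunE /crosses; move: (x (inr f)) => a.
by case: (_ \in U); case: (_ \in U) => /=; case: (ltP a 0) => /=; lia.
Qed.

Lemma gen_pairing_slack_normal x U g : 0 <= gen_pairing (slack_normal x U) g.
Proof.
case: g => [u|[f [[|[|[|k]]] kP]]] /=; rewrite ?/crosses //.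
all: case: (_ \in U); rewrite /=.
all: try (case: (_ \in U)); rewrite //=.
all: by case: (_ < 0).
Qed.

(** At [x] the weight and the slacks agree with linear functionals that are [1], respectively
    nonnegative, on every generator. *)
Lemma in_dilate_feasible j x :
  in_dilate ends R j x -> feasible setT setT ends j (twist (-1) x).
Proof.
case=> mu [mu0 [mu1 xE]]; split.
- by move=> u; rewrite inE.
- by move=> f; rewrite inE.
- rewrite weight_twist; apply/eqP; rewrite -(eqr_int R) (pairing_dilate _ xE).
  rewrite -[j%:Z%:~R]/j%:R -mu1; apply/eqP/eq_bigr => g _.
  suff -> : gen_pairing (fun=> 1) g = 1 by rewrite mulr1.
  by case: g => [u|[f [[|[|[|k]]] kP]]].
- move=> U; rewrite slack_twist -(ler0z R) (pairing_dilate _ xE).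
  by apply: sumr_ge0 => g _; rewrite mulr_ge0 // ler0z gen_pairing_slack_normal.
Qed.

Definition add_gen (k : nat) (g : gen_index V E) x :=
  [ffun i => x i + k%:Z * gen ends g i] : {ffun Defs.coord V E -> int}.

Lemma in_dilate_add j k g x :
  in_dilate ends R j x -> in_dilate ends R (j + k) (add_gen k g x).
Proof.
case=> mu [mu0 [mu1 xE]].
exists (fun h => mu h + k%:R * (h == g)%:R); split.
  by move=> h; rewrite addr_ge0 // mulr_ge0.
have sumg (F : gen_index V E -> R) : \sum_h k%:R * (h == g)%:R * F h = k%:R * F g.
  rewrite (bigD1 g) //= eqxx mulr1 big1 ?addr0 // => h /negPf ->.
  by rewrite mulr0 mul0r.
split.
  rewrite big_split /= mu1 natrD; congr (_ + _).
  rewrite -[RHS]mulr1 -(sumg (fun=> 1)).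
  by apply: eq_bigr => h _; rewrite mulr1.
move=> i; under eq_bigr do rewrite mulrDl.
by rewrite big_split /= -xE sumg ffunE rmorphD rmorphM.
Qed.

Lemma nonneg_point_in_dilate j x :
  nonneg_point setT j x -> in_dilate ends R j x.
Proof.
case=> _ xE tot pos.
exists (fun g => if g is inl u then (x (inl u))%:~R else 0); split.
  by case=> // u; rewrite ler0z.
split.
  rewrite big_sumType /= [X in _ + X]big1 // addr0.
  rewrite -[j%:R]/(j%:Z%:~R) -tot /weight rmorphD !rmorph_sum /=.
  by rewrite [X in _ = _ + X]big1 ?addr0 // => f _; rewrite xE normr0.
move=> i; rewrite big_sumType /= [X in _ + X]big1 ?addr0; last first.
  by move=> g _; rewrite mul0r.
have -> : \sum_u (x (inl u))%:~R * (basis (inl u) i)%:~R =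
    (\sum_u x (inl u) * (inl u == i)%:Z)%:~R :> R.
  rewrite rmorph_sum; apply: eq_bigr => u _.
  by rewrite ffunE rmorphM eq_sym.
congr (_%:~R); case: i => [u|f].
  rewrite -[LHS]mulr1 -(sum_mul_eq_op predT u (fun u => x (inl u))).
  exact: eq_bigr.
by rewrite xE big1 // => u _; rewrite mulr0.
Qed.

(* Truncating [t] to the interval gives the part of the shift needing no capacity. *)
Lemma feasible_split_edge (W : {set V}) (S : {set E}) j f (c : nat) y :
  (ends f).1 != (ends f).2 -> (ends f).1 \in W -> (ends f).2 \in W ->
  f \notin S -> y (inr f) = 0 ->
  feasible W (f |: S) ends (j + c) (add_at (inr f) c y) ->
  exists z s, [/\ feasible W S ends j z, `|s| <= c%:Z & y = shift_edge ends f s z].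
Proof.
move=> uv uW vW fS yf fy.
have /(feasible_shift_edge _ _ _ uv uW vW fS) [z [t [fz yE tb]]] :=
  conj yf fy.
have AB := min_slack_contract uv fz.
move: tb AB; set A := - min_slack _ _ _ _; set B := min_slack _ _ _ _ => tb AB.
pose t0 := Num.max A (Num.min B t).
have t0b : A <= t0 <= B by rewrite /t0; lia.
exists (shift_edge ends f t0 z), (t - t0); split.
- by apply/(feasible_shift_edge0 _ _ uv uW vW fS); exists z, t0.
- by rewrite /t0; lia.
- by rewrite shift_edgeK subrK.
Qed.

(** The generators are found edge by edge: the edge value and the flow along the edge are paid for
    with its four points, and the vertex values left at the end are nonnegative. *)
Lemma feasible_in_dilate (S : {set E}) j y :
  feasible setT S ends j y -> in_dilate ends R j (twist 1 y).
Proof.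
have [n] := ubnP #|S|; elim: n S j y => // n IH S j y nS fy.
have [S0|[f fS]] := set_0Vmem S.
  rewrite S0 in fy; have /feasible_no_edges np := fy.
  have -> : twist 1 y = y; last exact: nonneg_point_in_dilate.
  have [_ yE _ _] := np.
  apply/ffunP => -[u|f]; rewrite ffunE // big1 ?mulr0 ?addr0 // => f _.
  by rewrite yE oppr0 maxxx mulr0.
have fS' : f \notin S :\ f by rewrite !inE eqxx.
have nS' : (#|S :\ f| < n)%N by rewrite -ltnS (leq_trans _ nS) // (cardsD1 f S) fS.
have aj := feasible_edge_le f fy.
pose a := y (inr f); pose y0 := add_at (inr f) (- a) y.
have y0f : y0 (inr f) = 0 by rewrite add_at_same subrr.
have yE : y = add_at (inr f) a y0 by rewrite add_at_add_at subrr add_at0.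
rewrite -/a in aj; rewrite yE -(setD1K fS) in fy.
have free : a <= 0 \/ (ends f).1 = (ends f).2 ->
    in_dilate ends R (j - absz a) (twist 1 y0).
  move=> acr; apply: (IH (S :\ f)) => //.
  exact/(feasible_add_at_edge _ fS' y0f aj acr).
have jE : j = ((j - absz a) + absz a)%N by lia.
rewrite yE twist_add_edge // jE mul1r.
(* A nonpositive [a] is paid for by [-a] copies of [e_u + e_v - e_f], whose vertex part is what
   [twist 1] adds. *)
have [a0|a0] := leP a 0.
  have -> : add_at (inr f) a (add_at (inl (ends f).1) (Num.max (- a) 0)
      (add_at (inl (ends f).2) (Num.max (- a) 0) (twist 1 y0))) =
      add_gen (absz a) (inr (f, inord 1)) (twist 1 y0).
    apply/ffunP => i; rewrite [RHS]ffunE /= inordK // !ffunE /=.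
    have -> : (absz a)%:Z = - a by lia.
    by rewrite max_l; [ring|lia].
  by apply: in_dilate_add; apply: free; left.
rewrite max_r ?add_at0; last by lia.
have [uv|uv] := eqVneq (ends f).1 (ends f).2.
  have -> : add_at (inr f) a (twist 1 y0) =
      add_gen (absz a) (inr (f, inord 0)) (twist 1 y0).
    apply/ffunP => i; rewrite [RHS]ffunE /= inordK // !ffunE /=.
    by have -> : (absz a)%:Z = a by lia.
  by apply: in_dilate_add; apply: free; right.
have aE : a = (absz a)%:Z by lia.
rewrite aE {1}jE in fy.
have [//|//|z [s [fz sa y0E]]] := feasible_split_edge uv _ _ fS' y0f fy.
rewrite y0E /shift_edge !twist_add_vertex.
(* Of the [a] units of capacity, [|s|] carry the shift as copies of a directed generator, chosen by
   the sign of [s]; the other [a - |s|] are copies of [e_f]. *)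
have cE : absz a = (absz a - absz s + absz s)%N by lia.
rewrite [X in in_dilate _ _ (_ + X)]cE addnA.
have dz := in_dilate_add (absz a - absz s) (inr (f, inord 0)) (IH _ _ _ nS' fz).
have cE' : (absz a - absz s)%N%:Z = a - `|s| by lia.
have [s0|s0] := leP 0 s.
  have := in_dilate_add (absz s) (inr (f, inord 3)) dz.
  congr in_dilate; apply/ffunP => i.
  rewrite [LHS]ffunE /= inordK // !ffunE /= inordK // !ffunE cE' ger0_norm //.
  have -> : (absz s)%:Z = s by lia.
  by ring.
have := in_dilate_add (absz s) (inr (f, inord 2)) dz.
congr in_dilate; apply/ffunP => i.
rewrite [LHS]ffunE /= inordK // !ffunE /= inordK // !ffunE cE' ltr0_norm //.
have -> : (absz s)%:Z = - s by lia.
by ring.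
Qed.

Lemma in_dilateE j x :
  in_dilate ends R j x <-> feasible setT setT ends j (twist (-1) x).
Proof.
split; first exact: in_dilate_feasible.
by move=> /feasible_in_dilate; rewrite twist_twist subrr twist0.
Qed.

End Real.
End Dilates.

Theorem mainTheorem11 (R : realType) (V E : finType) (ends : E -> V * V) :
  cosmo_hstar ends R
    (\sum_(H : {set E} | `[< acyclic ends H >])
        (2%:P * 'X) ^+ #|H| * (1 + 'X) ^+ (#|E| - #|H|)).
Proof.
move=> j.
have cnt : has_card (in_dilate ends R j)
    (ehrhart_coef (#|[set: V]| + #|[set: E]|) (forest_sum ends setT) j).
  apply: (has_card_image (F := twist ends 1) (P := feasible setT setT ends j)).
  - move=> x y _ _ /(congr1 (twist ends (-1))).
    by rewrite !twist_twist addNr !twist0.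
  - move=> x; split=> [/in_dilateE fx|[y fy ->]].
      by exists (twist ends (-1) x); rewrite // twist_twist subrr twist0.
    by apply/in_dilateE; rewrite twist_twist addNr twist0.
  - by apply: has_card_feasible => f _; rewrite !inE.
have [s [us sP sz]] := cnt.
exists (size s); split; first by exists s.
rewrite sz !cardsT; congr (ehrhart_coef _ _ _).
rewrite /forest_sum cardsT; apply: eq_bigl => H.
by rewrite subsetT.
Qed.
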